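(* Let $\mathbf{\Sigma}_2=\mathbf{L}_2+\mathbf{S}_2$ and $\mathbf{\Sigma}_1=\mathbf{\Sigma}_2+\mathbf{H}$ be two $p\times p$ matrices, and let $\mathbf{\Delta}_{1,n}=\mathbf{\Sigma}_1-\mathbf{\Sigma}_n$, $\mathbf{\Delta}_{2,n}=\mathbf{\Sigma}_2-\mathbf{\Sigma}_n$, so that $\mathbf{H}=\mathbf{\Delta}_{1,n}-\mathbf{\Delta}_{2,n}$ is a perturbation matrix. Set $\mathbf{d}(\mathbf{\Sigma}_1,\mathbf{\Sigma}_2)=\mathbf{g}(\mathbf{\Sigma}_1)-\mathbf{g}(\mathbf{\Sigma}_2)$. Then $$\|\mathbf{d}(\mathbf{\Sigma}_1,\mathbf{\Sigma}_2)\|_F\le\tfrac52\|\mathbf{H}\|_F .$$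
   Context: $\mathbf{\Sigma}_n$ is the $p\times p$ sample covariance matrix. For a $p\times p$ matrix $\mathbf{\Sigma}=\mathbf{L}+\mathbf{S}$ let $\mathbf{\Delta}_n=\mathbf{\Sigma}-\mathbf{\Sigma}_n$, $\varphi(\mathbf{\Sigma})=\mathbf{I}_p+\mathbf{\Delta}_n\mathbf{\Delta}_n'$ and $\phi_D(\mathbf{L},\mathbf{S})=\tfrac12\ln\det\varphi(\mathbf{\Sigma})$, whose gradient with respect to $\mathbf{L}$ and with respect to $\mathbf{S}$ is $\varphi(\mathbf{\Sigma})^{-1}\mathbf{\Delta}_n$. The $2p^2$-dimensional vectorized gradient is $$\mathbf{g}(\mathbf{\Sigma})=\bigl(\mathrm{vec}[\varphi(\mathbf{\Sigma})^{-1}\mathbf{\Delta}_n]',\ \mathrm{vec}[\varphi(\mathbf{\Sigma})^{-1}\mathbf{\Delta}_n]'\bigr)'.$$ $\|\cdot\|_F$ is the Frobenius norm of a matrix, and the Euclidean norm of a vector. *)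

(* Defs.v *)
From mathcomp Require Import all_boot all_order all_algebra.
From mathcomp Require Import reals.

Set Implicit Arguments.
Unset Strict Implicit.
Unset Printing Implicit Defensive.

Import GRing.Theory Num.Theory.
Local Open Scope ring_scope.

(* On column vectors (n = 1) this is the Euclidean norm.  The canonical norm
   that mathcomp-analysis puts on matrices is the max norm, not this one. *)
Definition frob_norm (R : realType) (m n : nat) (A : 'M[R]_(m, n)) : R :=
  Num.sqrt (\sum_i \sum_j A i j ^+ 2).

(* Column-stacking vectorization; mxvec is row-major, hence the transpose. *)
Definition vec (R : realType) (m n : nat) (A : 'M[R]_(m, n)) : 'cV[R]_(n * m) :=
  (mxvec A^T)^T.

Definition sample_mean (R : realType) (n p : nat) (X : 'M[R]_(n, p)) : 'rV[R]_p :=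
  n%:R^-1 *: \sum_k row k X.

(* The rows of X are the n observations.  The flags select among the usual
   conventions: deviations from the sample mean (centred) or from a known zero
   mean; divisor n - 1 (unbiased) or n. *)
Definition sample_cov (R : realType) (centred unbiased : bool) (n p : nat)
    (X : 'M[R]_(n, p)) : 'M[R]_p :=
  let m := if centred then sample_mean X else 0 in
  (n - unbiased)%:R^-1 *: \sum_k (row k X - m)^T *m (row k X - m).

Definition Delta (R : realType) (p : nat) (Sigma_n Sigma : 'M[R]_p) : 'M[R]_p :=
  Sigma - Sigma_n.

Definition varphi (R : realType) (p : nat) (Sigma_n Sigma : 'M[R]_p) : 'M[R]_p :=
  1%:M + Delta Sigma_n Sigma *m (Delta Sigma_n Sigma)^T.

(* The common gradient, with respect to L and with respect to S, of
   (L, S) |-> 1/2 * ln (det (varphi (L + S))).  The matrix varphi is symmetric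
   positive definite, so invmx is a genuine inverse here. *)
Definition grad (R : realType) (p : nat) (Sigma_n Sigma : 'M[R]_p) : 'M[R]_p :=
  invmx (varphi Sigma_n Sigma) *m Delta Sigma_n Sigma.

Definition g (R : realType) (p : nat) (Sigma_n Sigma : 'M[R]_p) :
    'cV[R]_(p * p + p * p) :=
  col_mx (vec (grad Sigma_n Sigma)) (vec (grad Sigma_n Sigma)).

Definition d (R : realType) (p : nat) (Sigma_n Sigma1 Sigma2 : 'M[R]_p) :
    'cV[R]_(p * p + p * p) :=
  g Sigma_n Sigma1 - g Sigma_n Sigma2.

(* Main.v *)
Require Import Defs.
From mathcomp Require Import all_boot all_order all_algebra.
From mathcomp Require Import reals.
From mathcomp Require Import ring lra.

Set Implicit Arguments.
Unset Strict Implicit.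
Unset Printing Implicit Defensive.

Import Order.TTheory GRing.Theory Num.Theory.
Local Open Scope ring_scope.

(** Write A, B for the two values of Delta, M = 1 + A A^T and K = 1 + B^T B.
    Since (1 + B B^T)^-1 B = B K^-1,
      M^-1 A - B K^-1 = M^-1 (A - B) K^-1 - (M^-1 A) (A - B)^T (B K^-1).
    Here M^-1 and K^-1 are contractions, while M^-1 A and B K^-1 have operator
    norm at most 1/2.  Hence the square norm of the difference of the gradients
    is at most 2 (1 + 1/16) times that of H, and the duplicated gradient doubles
    this to 17/4 < (5/2)^2. *)

Section SquareNorm.
Variable R : realType.

(** The square of [frob_norm]: all estimates stay linear in these squares, within reach of [lra],
    and roots appear only in the theorem. *)
Definition sqnorm m n (A : 'M[R]_(m, n)) : R := \sum_i \sum_j A i j ^+ 2.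

Lemma sqnorm_ge0 m n (A : 'M[R]_(m, n)) : 0 <= sqnorm A.
Proof. by apply: sumr_ge0 => i _; apply: sumr_ge0 => j _; exact: sqr_ge0. Qed.

Lemma sqnorm_eq0 m n (A : 'M[R]_(m, n)) : sqnorm A = 0 -> A = 0.
Proof.
move=> /psumr_eq0P A0; apply/matrixP=> i j; rewrite mxE.
have /psumr_eq0P Ai0 := A0 (fun i _ => sumr_ge0 _ (fun j _ => sqr_ge0 _)) i isT.
by apply/eqP; rewrite -sqrf_eq0 (Ai0 (fun j _ => sqr_ge0 _) j isT).
Qed.

Lemma sqnormT m n (A : 'M[R]_(m, n)) : sqnorm A^T = sqnorm A.
Proof.
rewrite /sqnorm exchange_big; apply: eq_bigr => i _.
by apply: eq_bigr => j _; rewrite mxE.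
Qed.

Lemma sqnorm_col_mx m1 m2 n (A : 'M[R]_(m1, n)) (B : 'M[R]_(m2, n)) :
  sqnorm (col_mx A B) = sqnorm A + sqnorm B.
Proof.
rewrite /sqnorm big_split_ord; congr (_ + _); apply: eq_bigr => i _;
  by apply: eq_bigr => j _; rewrite ?col_mxEu ?col_mxEd.
Qed.

Lemma sqnorm_mxvec m n (A : 'M[R]_(m, n)) : sqnorm (mxvec A) = sqnorm A.
Proof.
rewrite /sqnorm big_ord1 pair_big.
rewrite (reindex _ (curry_mxvec_bij _ _)) /=.
by apply: eq_bigr => -[i j] _; rewrite /= mxvecE.
Qed.

Lemma sqnorm_vec m n (A : 'M[R]_(m, n)) : sqnorm (vec A) = sqnorm A.
Proof. by rewrite sqnormT sqnorm_mxvec sqnormT. Qed.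

Lemma vecB m n (A B : 'M[R]_(m, n)) : vec (A - B) = vec A - vec B.
Proof. by rewrite /vec !linearB. Qed.

Lemma sqnorm_trace m n (A : 'M[R]_(m, n)) : sqnorm A = \tr (A^T *m A).
Proof.
rewrite -sqnormT; apply: eq_bigr => i _; rewrite mxE.
by apply: eq_bigr => j _; rewrite mxE expr2.
Qed.

Lemma sqnormD m n (A B : 'M[R]_(m, n)) :
  sqnorm (A + B) = sqnorm A + 2 * \tr (A^T *m B) + sqnorm B.
Proof.
have trBA : \tr (B^T *m A) = \tr (A^T *m B).
  by rewrite -mxtrace_tr trmx_mul trmxK.
rewrite !sqnorm_trace [(A + B)^T]linearD /= mulmxDl !mulmxDr !linearD /= trBA; ring.
Qed.

Lemma sqnormN m n (A : 'M[R]_(m, n)) : sqnorm (- A) = sqnorm A.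
Proof.
by apply: eq_bigr => i _; apply: eq_bigr => j _; rewrite mxE sqrrN.
Qed.

Lemma sqnormB m n (A B : 'M[R]_(m, n)) :
  sqnorm (A - B) = sqnorm A - 2 * \tr (A^T *m B) + sqnorm B.
Proof. by rewrite sqnormD sqnormN mulmxN linearN /= mulrN. Qed.

(** Parallelogram law, with the square norm of [A + B] dropped. *)
Lemma sqnormB_le m n (A B : 'M[R]_(m, n)) :
  sqnorm (A - B) <= 2 * (sqnorm A + sqnorm B).
Proof. by have := sqnorm_ge0 (A + B); rewrite sqnormB sqnormD; lra. Qed.

Definition gram1 m n (A : 'M[R]_(m, n)) : 'M[R]_m := 1%:M + A *m A^T.

Lemma tr_gram1 m n (A : 'M[R]_(m, n)) : (gram1 A)^T = gram1 A.
Proof. by rewrite /gram1 [(_ + _)^T]linearD /= trmx1 trmx_mul trmxK. Qed.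

Lemma trace_gram m n k (A : 'M[R]_(m, n)) (Y : 'M[R]_(m, k)) :
  \tr (Y^T *m (A *m A^T *m Y)) = sqnorm (A^T *m Y).
Proof. by rewrite sqnorm_trace trmx_mul trmxK !mulmxA. Qed.

(** The cross term 2 <Y, A A^T Y> equals 2 |A^T Y|^2, hence is nonnegative. This yields both the
    invertibility of [gram1 A] and the contractivity of its inverse. *)
Lemma sqnorm_gram1_ge m n k (A : 'M[R]_(m, n)) (Y : 'M[R]_(m, k)) :
  sqnorm Y <= sqnorm (gram1 A *m Y).
Proof.
rewrite mulmxDl mul1mx sqnormD trace_gram.
have := sqnorm_ge0 (A^T *m Y); have := sqnorm_ge0 (A *m A^T *m Y); lra.
Qed.

(* AM-GM: with P = A A^T, |Y + P Y|^2 = |Y - P Y|^2 + 4 <Y, P Y>. *)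
Lemma sqnorm_gram1_ge4 m n k (A : 'M[R]_(m, n)) (Y : 'M[R]_(m, k)) :
  4 * sqnorm (A^T *m Y) <= sqnorm (gram1 A *m Y).
Proof.
rewrite mulmxDl mul1mx sqnormD trace_gram.
have := sqnorm_ge0 (Y - A *m A^T *m Y); rewrite sqnormB trace_gram; lra.
Qed.

Lemma gram1_unitmx m n (A : 'M[R]_(m, n)) : gram1 A \in unitmx.
Proof.
rewrite -row_free_unit -kermx_eq0 -trmx_eq0; apply/eqP/sqnorm_eq0/le_anti.
rewrite sqnorm_ge0 andbT (le_trans (sqnorm_gram1_ge A _)) //.
(* By symmetry, [gram1 A] kills the transposed kernel matrix, so the lower bound forces that matrix
   to vanish. *)
rewrite -[X in X *m _]tr_gram1 -trmx_mul mulmx_ker trmx0.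
by rewrite /sqnorm big1 // => i _; rewrite big1 // => j _; rewrite mxE expr0n.
Qed.

(** Push-through identity: A (1 + A^T A) = (1 + A A^T) A. *)
Lemma invmx_gram1_mulC m n (A : 'M[R]_(m, n)) :
  invmx (gram1 A) *m A = A *m invmx (gram1 A^T).
Proof.
apply: (canLR (mulKmx (gram1_unitmx A))); rewrite mulmxA.
apply: (canRL (mulmxK (gram1_unitmx A^T))).
by rewrite /gram1 trmxK mulmxDl mulmxDr mul1mx mulmx1 mulmxA.
Qed.

Lemma sqnorm_invmx_gram1 m n k (A : 'M[R]_(m, n)) (X : 'M[R]_(m, k)) :
  sqnorm (invmx (gram1 A) *m X) <= sqnorm X.
Proof.
by have := sqnorm_gram1_ge A (invmx (gram1 A) *m X); rewrite mulKVmx ?gram1_unitmx.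
Qed.

(** Matrix analogue of a / (1 + a^2), a function bounded by 1/2 in absolute value. *)
Definition log_grad m n (A : 'M[R]_(m, n)) := invmx (gram1 A) *m A.

Lemma tr_log_grad m n (A : 'M[R]_(m, n)) : (log_grad A)^T = log_grad A^T.
Proof.
by rewrite /log_grad trmx_mul trmx_inv tr_gram1 invmx_gram1_mulC trmxK.
Qed.

(** The operator norm bound 1/2, squared: the AM-GM estimate for [A^T] at Y = (1 + A^T A)^-1 X,
    where A Y is [log_grad A *m X] by push-through. *)
Lemma sqnorm_log_grad_mul m n k (A : 'M[R]_(m, n)) (X : 'M[R]_(n, k)) :
  4 * sqnorm (log_grad A *m X) <= sqnorm X.
Proof.
have := sqnorm_gram1_ge4 A^T (invmx (gram1 A^T) *m X).
by rewrite mulKVmx ?gram1_unitmx // trmxK mulmxA -invmx_gram1_mulC.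
Qed.

Lemma log_grad_sub m n (A B : 'M[R]_(m, n)) :
  log_grad A - log_grad B =
  invmx (gram1 A) *m ((A - B) *m invmx (gram1 B^T))
  - log_grad A *m ((A - B)^T *m log_grad B).
Proof.
have -> : log_grad B = B *m invmx (gram1 B^T) by exact: invmx_gram1_mulC.
(* Clearing both inverses, M on the left and K on the right, leaves A K - M B = (A - B) - A (A -
   B)^T B. *)
apply: (can_inj (mulKmx (gram1_unitmx A))).
apply: (can_inj (mulmxK (gram1_unitmx B^T))).
rewrite /log_grad !(mulmxBr, mulmxBl, linearB) /= !mulmxA.
rewrite !mulmxV ?gram1_unitmx // !mul1mx !mulmxKV ?gram1_unitmx //.
rewrite /gram1 trmxK !mulmxDr !mulmxDl !mulmx1 !mul1mx !mulmxA.
by apply/matrixP=> i j; rewrite !mxE; ring.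
Qed.

Lemma sqnorm_log_grad_sub m n (A B : 'M[R]_(m, n)) :
  sqnorm (log_grad A - log_grad B) <= 17 / 8 * sqnorm (A - B).
Proof.
rewrite log_grad_sub; apply: (le_trans (sqnormB_le _ _)).
have := sqnorm_invmx_gram1 A ((A - B) *m invmx (gram1 B^T)).
have := sqnorm_invmx_gram1 B^T (A - B)^T.
(* Transposition turns the bound for left factors into one for the right factor K^-1; the same
   device serves for [log_grad B] below. *)
rewrite -sqnormT trmx_mul trmxK trmx_inv tr_gram1 sqnormT.
have := sqnorm_log_grad_mul A ((A - B)^T *m log_grad B).
have := sqnorm_log_grad_mul B^T (A - B).
rewrite -[X in 4 * X <= _]sqnormT trmx_mul tr_log_grad trmxK; lra.
Qed.

End SquareNorm.

Theorem propositionE1 (R : realType) (n p : nat) (X : 'M[R]_(n, p))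
    (centred unbiased : bool) (hn : (unbiased < n)%N)
    (Sigma_n : 'M[R]_p) (hSigma_n : Sigma_n = sample_cov centred unbiased X)
    (L2 S2 H Sigma1 Sigma2 : 'M[R]_p)
    (hSigma2 : Sigma2 = L2 + S2) (hSigma1 : Sigma1 = Sigma2 + H) :
  frob_norm (d Sigma_n Sigma1 Sigma2) <= 5 / 2 * frob_norm H.
Proof.
have H_def : H = Delta Sigma_n Sigma1 - Delta Sigma_n Sigma2.
  by rewrite /Delta hSigma1 opprB addrA subrK addrC addKr.
(* [grad] is [log_grad] of [Delta] by unfolding, and the two equal blocks of [g] give the factor
   2. *)
have d_def : sqnorm (d Sigma_n Sigma1 Sigma2) =
    2 * sqnorm (log_grad (Delta Sigma_n Sigma1) - log_grad (Delta Sigma_n Sigma2)).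
  rewrite /d /g opp_col_mx add_col_mx sqnorm_col_mx -/(grad _ _).
  by rewrite -vecB sqnorm_vec mulr_natl mulr2n.
have le_d := sqnorm_log_grad_sub (Delta Sigma_n Sigma1) (Delta Sigma_n Sigma2).
(* Needed to relax the constant 17/4 to 25/4 in the final [lra]. *)
have le_H := sqnorm_ge0 H.
rewrite -H_def in le_d.
rewrite /frob_norm -/(sqnorm _) -/(sqnorm H).
have -> : 5 / 2 = Num.sqrt ((5 / 2) ^+ 2) :> R.
  by rewrite sqrtr_sqr ger0_norm //; lra.
rewrite -sqrtrM ?sqr_ge0 // ler_wsqrtr // d_def; lra.
Qed.
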